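(* Let $w,x\in\{0,1\}^{\mathbb Z}$ be periodic with $w\le x$, let $\rho$ be the unique $\sigma\times\sigma$-invariant probability measure on the (finite) orbit of $(w,x)$, and let $\varphi\colon\{0,1\}^{\mathbb Z}\to\mathbb R$ be of the form $\varphi(y)=\varphi(y_0,y_1)$. Then \[ \mathcal P_{[w,x],\varphi}=\log_2\lambda_++\sum_{a,b\in\{0,1\}}\sum_{\ell\ge2}m_{a,b}^\ell\log_2C_{a,b}^++\sum_{a,b\in\{0,1\}}\sum_{\ell\ge2}m_{a,b}^\ell\log_2\Big(1+\frac{C_{a,b}^-}{C_{a,b}^+}\Big(\frac{\lambda_-}{\lambda_+}\Big)^{\ell-1}\Big), \] where $m_{a,b}^\ell:=\rho\big(\{(u,v):u_0=a,\ v_0=a,\ u_j=0,\ v_j=1\ (1\le j\le\ell-2),\ u_{\ell-1}=v_{\ell-1}=b\}\big)$ (all sums are finite).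
   Context: $\sigma$ is the left shift; $\le$ is coordinatewise; $[w,x]=\{\sigma^ny:w\le y\le x,\ n\in\mathbb Z\}$ (closed here since $w,x$ are periodic). Let $\mathbf M=\begin{pmatrix}2^{\varphi(0,0)}&2^{\varphi(0,1)}\\2^{\varphi(1,0)}&2^{\varphi(1,1)}\end{pmatrix}$; it has two distinct real eigenvalues $\lambda_-<\lambda_+$ with $\lambda_+>|\lambda_-|$, $\lambda_+>0$. For $a,b\in\{0,1\}$ the constants $C_{a,b}^\pm$ are the unique reals with $(\mathbf M^{n-1})_{a,b}=C_{a,b}^+\lambda_+^{n-1}+C_{a,b}^-\lambda_-^{n-1}$ for all $n\ge1$; one has $C_{a,b}^+>0$. Topological pressure: $\mathcal P_{X,\varphi}=\lim_n\frac1n\log_2\sum_{A\in\mathcal L_n(X)}2^{\sup_{y\in A}\varphi^{(n)}(y)}$, with $\mathcal L_n(X)$ the $n$-blocks of $X$ and $\varphi^{(n)}=\sum_{j<n}\varphi\circ\sigma^j$. *)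

(* Defs.v *)
From HB Require Import structures.
From mathcomp Require Import all_boot all_order all_algebra.
From mathcomp Require Import all_classical all_reals all_analysis.
Set Implicit Arguments. Unset Strict Implicit. Unset Printing Implicit Defensive.
Import Order.TTheory GRing.Theory Num.Theory.
Local Open Scope ring_scope.
Local Open Scope classical_set_scope.

Definition conf := int -> 'I_2.

Definition shiftn (n : int) (y : conf) : conf := fun i => y (i + n).

Definition cle (y z : conf) : Prop := forall i, (y i <= z i)%N.

Definition interval_shift (w x : conf) : set conf :=
  [set z | exists y n, cle w y /\ cle y x /\ z = shiftn n y].

Definition cyl (n : nat) (A : {ffun 'I_n -> 'I_2}) : set conf :=
  [set y | forall i : 'I_n, y (i%:Z) = A i].
Definition blocks (X : set conf) (n : nat) (A : {ffun 'I_n -> 'I_2}) : Prop :=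
  exists y, X y /\ cyl A y.

Definition log2 {R : realType} (t : R) : R := ln t / ln 2.

Definition birk {R : realType} (phi : 'I_2 -> 'I_2 -> R) (n : nat) (y : conf) : R :=
  \sum_(j < n) phi (y (j%:Z)) (y (j.+1%:Z)).

Definition pressure_seq {R : realType} (X : set conf) (phi : 'I_2 -> 'I_2 -> R)
  (n : nat) : R :=
  (n%:R)^-1 * log2 (\sum_(A : {ffun 'I_n -> 'I_2} | `[< blocks X A >])
                       (2 : R) `^ (sup [set birk phi n y | y in X `&` cyl A])).

Definition Mphi {R : realType} (phi : 'I_2 -> 'I_2 -> R) : 'M[R]_2 :=
  \matrix_(a, b) ((2 : R) `^ (phi a b)).

Definition zero2 : 'I_2 := ord0.
Definition one2 : 'I_2 := ord_max.

Definition mcond (l : nat) (a b : 'I_2) (u v : conf) : bool :=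
  [&& u 0 == a, v 0 == a,
      [forall j : 'I_l, ((1 <= j) && (j <= l - 2))%N ==>
                        ((u (j : nat)%:Z == zero2) && (v (j : nat)%:Z == one2))],
      u (l.-1)%:Z == b & v (l.-1)%:Z == b].

(* m^l_{a,b} = rho(cylinder), where rho is the unique sigma x sigma-invariant
   probability measure on the (finite) orbit of (w,x).  For p > 0 a common
   period of w and x, rho = (1/p) sum_{k<p} delta_{(sigma^k w, sigma^k x)}. *)
Definition mrho {R : realType} (w x : conf) (p : nat) (l : nat) (a b : 'I_2) : R :=
  (#|[set k : 'I_p | mcond l a b (shiftn (k : nat)%:Z w) (shiftn (k : nat)%:Z x)]|)%:R
  / (p%:R).

Definition periodic_with (y : conf) (p : nat) : Prop :=
  forall i : int, y (i + p%:Z) = y i.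

(* Main.v *)
(** Call a position where w and x agree pinned. The words squeezed between w and
x, weighted by products of entries of M = Mphi phi, are counted by a transfer
operator; between two consecutive pinned positions k and k + d, carrying the
symbols a and b, everything is free, so the total weight is multiplied by
M^d(a,b) = lp^d C+(a,b) (1 + C-(a,b)/C+(a,b) (lm/lp)^d). Periodicity makes the
product of these factors over one period the exact growth factor of the weights
over one period, and its logarithm is what the sums against m^l_{a,b} collect.
Without pinned positions the weights are sums of entries of M^n, of order lp^n.
The pressure sums are comparable to the weights up to constants: the supremum
over a cylinder only involves one symbol beyond the word, and the words of the
interval shift are the compatible words started at one of p positions. *)

Require Import Defs.
From HB Require Import structures.
From mathcomp Require Import all_boot all_order all_algebra.
From mathcomp Require Import all_classical all_reals all_analysis.
From mathcomp Require Import zify ring lra.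
Set Implicit Arguments. Unset Strict Implicit. Unset Printing Implicit Defensive.
Import numFieldNormedType.Exports.
Import Order.TTheory GRing.Theory Num.Theory.
Local Open Scope ring_scope.
Local Open Scope classical_set_scope.

(** * Transfer operator on words squeezed between [w] and [x] *)

Section TransferOperator.

Variables (R : realType) (w x : conf) (A : 'M[R]_2).
Hypothesis hwx : cle w x.

Definition allowed (k : nat) (a : 'I_2) : bool := (w k%:Z <= a <= x k%:Z)%N.

(** Partition function of the words that start with [a] at position [k]; [n] counts transitions, so
    the words have [n.+1] symbols. *)
Fixpoint weight_from (k n : nat) (a : 'I_2) : R :=
  if allowed k a then
    if n is n'.+1 then \sum_b A a b * weight_from k.+1 n' b else 1
  else 0.

Definition weight (k n : nat) : R := \sum_a weight_from k n a.

Lemma weight_fromS k n a : allowed k a ->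
  weight_from k n.+1 a = \sum_b A a b * weight_from k.+1 n b.
Proof. by move=> /= ->. Qed.

Lemma weight_from0 k n a : ~~ allowed k a -> weight_from k n a = 0.
Proof. by case: n => [|n] /= /negbTE ->. Qed.

Definition cons_ffun n (u : 'I_2 * {ffun 'I_n -> 'I_2}) : {ffun 'I_n.+1 -> 'I_2} :=
  [ffun i => if unlift ord0 i is Some j then u.2 j else u.1].

Lemma cons_ffun0 n (u : 'I_2 * {ffun 'I_n -> 'I_2}) :
  cons_ffun u ord0 = u.1.
Proof. by rewrite ffunE unlift_none. Qed.

Lemma cons_ffunS n (u : 'I_2 * {ffun 'I_n -> 'I_2}) (i : 'I_n) :
  cons_ffun u (lift ord0 i) = u.2 i.
Proof. by rewrite ffunE liftK. Qed.

Lemma cons_ffun_bij n : bijective (@cons_ffun n).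
Proof.
exists (fun f : {ffun 'I_n.+1 -> 'I_2} => (f ord0, [ffun i => f (lift ord0 i)])).
- move=> [a f]; congr pair; first by rewrite cons_ffun0.
  by apply/ffunP => i; rewrite ffunE cons_ffunS.
- move=> f; apply/ffunP => i; case: (unliftP ord0 i) => [j|] ->.
    by rewrite cons_ffunS ffunE.
  by rewrite cons_ffun0.
Qed.

Definition compatible k n (f : {ffun 'I_n -> 'I_2}) : bool :=
  [forall i : 'I_n, allowed (k + i) (f i)].

Lemma compatible_cons k n (u : 'I_2 * {ffun 'I_n -> 'I_2}) :
  compatible k (cons_ffun u) = allowed k u.1 && compatible k.+1 u.2.
Proof.
apply/forallP/andP => [h | [h0 /forallP h] i].
- split; first by have := h ord0; rewrite cons_ffun0 addn0.
  by apply/forallP => i; have := h (lift ord0 i); rewrite cons_ffunS /= /bump /= addnS addSn.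
- case: (unliftP ord0 i) => [j|] ->; last by rewrite cons_ffun0 addn0.
  by rewrite cons_ffunS /= /bump /= add1n addnS -addSn.
Qed.

Definition word_weight n (f : {ffun 'I_n.+1 -> 'I_2}) : R :=
  \prod_(j < n) A (f (inord j)) (f (inord j.+1)).

Lemma word_weight_cons n a (f : {ffun 'I_n.+1 -> 'I_2}) :
  word_weight (cons_ffun (a, f)) = A a (f ord0) * word_weight f.
Proof.
rewrite /word_weight big_ord_recl /=; congr (A _ _ * _).
- have -> : inord 0 = ord0 :> 'I_n.+2 by apply/val_inj; rewrite /= inordK.
  by rewrite cons_ffun0.
- have -> : inord 1 = lift ord0 ord0 :> 'I_n.+2 by apply/val_inj; rewrite /= inordK.
  by rewrite cons_ffunS.
- apply: eq_bigr => j _; congr (A _ _).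
    have -> : inord (bump 0 j) = lift ord0 (inord j) :> 'I_n.+2.
      apply/val_inj; rewrite /= inordK /bump /= ?inordK //; case: j => j /= hj; lia.
    by rewrite cons_ffunS.
  have -> : inord (bump 0 j).+1 = lift ord0 (inord j.+1) :> 'I_n.+2.
    apply/val_inj; rewrite /= inordK /bump /= ?inordK //; case: j => j /= hj; lia.
  by rewrite cons_ffunS.
Qed.

(** The arbitrary factor [g] of the first symbol makes the induction go through: removing a first
    symbol [a] leaves the factor [A a (f ord0)], so the induction hypothesis is applied with
    [g := A a]. *)
Lemma sum_word_weight_start n : forall k (g : 'I_2 -> R),
  \sum_(f : {ffun 'I_n.+1 -> 'I_2} | compatible k f) g (f ord0) * word_weight f =
  \sum_a g a * weight_from k n a.
Proof.
elim: n => [|n IH] k g; rewrite (reindex _ (onW_bij _ (cons_ffun_bij _))) /=.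
- under eq_bigl do rewrite compatible_cons.
  under eq_bigr do rewrite cons_ffun0 /word_weight big_ord0 mulr1.
  rewrite big_mkcond /=.
  rewrite -(pair_big xpredT xpredT
    (fun a (f : {ffun 'I_0 -> 'I_2}) => if allowed k a && compatible k.+1 f then g a else 0)) /=.
  apply: eq_bigr => a _.
  have hc (f : {ffun 'I_0 -> 'I_2}) : compatible k.+1 f by apply/forallP; case.
  under eq_bigr do rewrite hc andbT.
  rewrite sumr_const card_ffun !card_ord expn0 mulr1n.
  by case: ifP; rewrite ?mulr1 ?mulr0.
- under eq_bigl do rewrite compatible_cons.
  rewrite big_mkcond /=.
  under eq_bigr => u _.
    rewrite cons_ffun0 [u]surjective_pairing word_weight_cons -surjective_pairing.
    over.
  rewrite -(pair_big xpredT xpredT (fun a (f : {ffun 'I_n.+1 -> 'I_2}) =>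
     if allowed k a && compatible k.+1 f
     then g a * (A a (f ord0) * word_weight f) else 0)) /=.
  apply: eq_bigr => a _; case: ifP => ha /=; last by rewrite mulr0 big1.
  rewrite -big_mkcond /= -IH mulr_sumr; exact: eq_bigr.
Qed.

Lemma sum_word_weight k n :
  \sum_(f : {ffun 'I_n.+1 -> 'I_2} | compatible k f) word_weight f = weight k n.
Proof.
have := sum_word_weight_start n k (fun=> 1).
under eq_bigr do rewrite mul1r.
by under [RHS]eq_bigr do rewrite mul1r.
Qed.

(** Summing over unconstrained intermediate symbols is matrix multiplication. The constraint at
    [k + d.+1] is still enforced, inside the remaining [weight_from]. *)
Lemma weight_from_free d n : forall k a, allowed k a ->
  (forall i b, (k < i <= k + d)%N -> allowed i b) ->
  weight_from k (d.+1 + n) a = \sum_b (A ^+ d.+1) a b * weight_from (k + d.+1) n b.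
Proof.
elim: d => [|d IH] k a ha hfree.
  by rewrite /= ha addn1.
rewrite addSn weight_fromS //.
under eq_bigr => b _.
  rewrite IH; last 2 first.
  - by apply: hfree; lia.
  - by move=> i c hi; apply: hfree; lia.
  rewrite mulr_sumr; over.
rewrite exchange_big /=; apply: eq_bigr => c _.
have -> : (A ^+ d.+2) a c = \sum_b A a b * (A ^+ d.+1) b c.
  by rewrite exprS -mulmxE mxE.
rewrite mulr_suml addSnnS.
by apply: eq_bigr => b _; rewrite mulrA.
Qed.

Definition pinned (k : nat) : bool := w k%:Z == x k%:Z.

Lemma allowed_pinned k a : pinned k -> allowed k a = (a == w k%:Z).
Proof.
move=> /eqP h; rewrite /allowed -h -eqn_leq eq_sym.
by apply/eqP/eqP => [/val_inj|->].
Qed.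

Lemma weight_pinned k n : pinned k -> weight k n = weight_from k n (w k%:Z).
Proof.
move=> hk; rewrite /weight (bigD1 (w k%:Z)) //= big1 ?addr0 // => a ha.
by rewrite weight_from0 // allowed_pinned.
Qed.

Lemma allowed_w k : allowed k (w k%:Z).
Proof. by rewrite /allowed leqnn hwx. Qed.

Lemma unpinned k : ~~ pinned k -> w k%:Z = zero2 /\ x k%:Z = one2.
Proof.
have := hwx k%:Z; rewrite /pinned -val_eqE.
case: (w k%:Z) (x k%:Z) => [[|[|?]] //= ?] [[|[|?]] //= ?] _ _; split; exact/val_inj.
Qed.

Lemma allowed_unpinned k a : ~~ pinned k -> allowed k a.
Proof.
by case/unpinned => h1 h2; rewrite /allowed h1 h2 /=; case: a => a /=; rewrite ltnS.
Qed.

(** A pinned position admits a single symbol, so at both ends of the gap the sums collapse and one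
    entry of the matrix power remains. *)
Lemma weight_gap k d n : pinned k -> pinned (k + d.+1) ->
  (forall i, (k < i <= k + d)%N -> ~~ pinned i) ->
  weight k (d.+1 + n) =
    (A ^+ d.+1) (w k%:Z) (w (k + d.+1)%N%:Z) * weight (k + d.+1) n.
Proof.
move=> hk hkd hfree; rewrite !weight_pinned // weight_from_free; last 2 first.
- by rewrite allowed_w.
- by move=> i b /hfree; exact: allowed_unpinned.
rewrite (bigD1 (w (k + d.+1)%N%:Z)) //= [X in _ + X]big1 ?addr0 // => b hb.
by rewrite weight_from0 ?mulr0 // allowed_pinned.
Qed.

Lemma weight_unpinned k n : (forall i, ~~ pinned i) ->
  weight k n.+1 = \sum_a \sum_b (A ^+ n.+1) a b.
Proof.
move=> hfree; apply: eq_bigr => a _.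
rewrite -[n.+1]addn0 weight_from_free ?addn0; last 2 first.
- exact: allowed_unpinned.
- by move=> *; exact: allowed_unpinned.
by apply: eq_bigr => b _; rewrite /= allowed_unpinned // mulr1.
Qed.

Variables (m K : R).
Hypotheses (hm : 0 < m) (hA : forall a b, m <= A a b <= K).

Lemma weight_from_ge0 n : forall k a, 0 <= weight_from k n a.
Proof.
elim: n => [|n IH] k a /=; case: ifP => // _.
apply: sumr_ge0 => b _; apply: mulr_ge0 => //.
by have /andP[h _] := hA a b; apply: le_trans h; exact: ltW.
Qed.

(** For the lower bound only the first symbol [w k] is kept; the 2 above counts the possible first
    symbols. This compares starting positions that need not be pinned. *)
Lemma weight_step k n :
  m * weight k.+1 n <= weight k n.+1 <= 2 * K * weight k.+1 n.
Proof.
rewrite /weight; apply/andP; split.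
- rewrite [leRHS](bigD1 (w k%:Z)) //= allowed_w.
  apply: le_trans (_ : \sum_b A (w k%:Z) b * weight_from k.+1 n b <= _); last first.
    rewrite lerDl; apply: sumr_ge0 => a _; exact: (weight_from_ge0 n.+1).
  rewrite mulr_sumr; apply: ler_sum => b _; apply: ler_wpM2r.
    exact: weight_from_ge0.
  by have /andP[] := hA (w k%:Z) b.
- have h a : weight_from k n.+1 a <= K * \sum_b weight_from k.+1 n b.
    rewrite mulr_sumr /=; case: ifP => _.
      apply: ler_sum => b _; apply: ler_wpM2r; first exact: weight_from_ge0.
      by have /andP[] := hA a b.
    apply: sumr_ge0 => b _; apply: mulr_ge0; last exact: weight_from_ge0.
    have /andP[h1 h2] := hA a b; apply: le_trans h2; apply: le_trans h1; exact: ltW.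
  apply: le_trans (ler_sum _ (fun a _ => h a)) _.
  by rewrite sumr_const card_ord -mulrA mulr_natl.
Qed.

Lemma weight_gt0 k n : 0 < weight k n.
Proof.
elim: n k => [|n IH] k.
- rewrite /weight (bigD1 (w k%:Z)) //= allowed_w.
  apply: lt_le_trans ltr01 _; rewrite lerDl; apply: sumr_ge0 => a _.
  exact: (weight_from_ge0 0).
- have /andP[h _] := weight_step k n; apply: lt_le_trans h; exact: mulr_gt0.
Qed.

End TransferOperator.

(** * Positive two-by-two matrices: eigenvalues and coefficients of the powers *)

Lemma sum_I2 (V : nmodType) (F : 'I_2 -> V) : \sum_a F a = F zero2 + F one2.
Proof. by rewrite big_ord_recr big_ord1; congr (F _ + F _); exact/val_inj. Qed.

Lemma I2P (P : 'I_2 -> Prop) : P zero2 -> P one2 -> forall a, P a.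
Proof.
move=> h0 h1 [[|[|//]] h]; first by rewrite (_ : Ordinal h = zero2) //; exact/val_inj.
by rewrite (_ : Ordinal h = one2) //; exact/val_inj.
Qed.

Section PositiveMatrix.

Variables (R : realType) (A : 'M[R]_2) (lp lm : R) (Cp Cm : 'I_2 -> 'I_2 -> R).
Hypotheses (hA : forall a b, 0 < A a b) (hlml : lm < lp).
Hypothesis hC : forall a b n, (A ^+ n) a b = Cp a b * lp ^+ n + Cm a b * lm ^+ n.

Lemma exprmx_gt0 n a b : 0 < (A ^+ n.+1) a b.
Proof.
elim: n a b => [//|n IH] a b.
rewrite exprS -mulmxE mxE sum_I2; apply: addr_gt0; exact: mulr_gt0.
Qed.

(* The Perron-Frobenius facts about lp, lm, Cp all come from hC at n = 0, 1, 2. *)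
Lemma coef_sum a b : Cp a b + Cm a b = (a == b)%:R.
Proof. by have := hC a b 0; rewrite !expr0 !mulr1 mxE => <-. Qed.

Lemma coef_sum1 a b : Cp a b * lp + Cm a b * lm = A a b.
Proof. by rewrite -[RHS]/((A ^+ 1) a b) hC !expr1. Qed.

Lemma coef_sum2 a b :
  Cp a b * lp ^+ 2 + Cm a b * lm ^+ 2 = A a zero2 * A zero2 b + A a one2 * A one2 b.
Proof. by rewrite -hC expr2 -mulmxE mxE sum_I2. Qed.

Lemma coef_lead a b : (lp - lm) * Cp a b = A a b - lm * (a == b)%:R.
Proof. by rewrite -coef_sum -coef_sum1; ring. Qed.

(** Off the diagonal [Cm = - Cp], so the entries of [A] and [A ^+ 2] are [Cp] times [lp - lm] and
    [lp ^+ 2 - lm ^+ 2]. Their quotient is [lp + lm], and a direct expansion of the square shows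
    that it is the trace. *)
Lemma eigen_trace : lp + lm = A zero2 zero2 + A one2 one2.
Proof.
have h0 := coef_sum zero2 one2; have h1 := coef_sum1 zero2 one2.
have h2 := coef_sum2 zero2 one2; rewrite /= in h0.
have hm : Cm zero2 one2 = - Cp zero2 one2 by apply/eqP; rewrite -addr_eq0 addrC h0.
have hne : A zero2 one2 != 0 by rewrite gt_eqF.
apply: (mulfI hne).
have -> : A zero2 one2 * (A zero2 zero2 + A one2 one2) =
  A zero2 zero2 * A zero2 one2 + A zero2 one2 * A one2 one2 by ring.
by rewrite -h2 -h1 hm; ring.
Qed.

(** The product equals [A zero2 one2 * A one2 zero2]: both are the variance of the values [lp], [lm]
    under the weights [Cp a a], [Cm a a], which sum to 1 and have mean [A a a]. *)
Lemma diag_between a : 0 < (A a a - lm) * (lp - A a a).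
Proof.
have h0 := coef_sum a a; have h1 := coef_sum1 a a; have h2 := coef_sum2 a a.
have ht := eigen_trace; rewrite eqxx mulr1n in h0.
have hd : 0 < A zero2 one2 * A one2 zero2 by exact: mulr_gt0.
have h : A zero2 one2 * A one2 zero2 =
    Cp a a * lp ^+ 2 + Cm a a * lm ^+ 2 - A a a ^+ 2.
  by rewrite h2; move: a {h0 h1 h2}; apply: I2P; ring.
have -> : (A a a - lm) * (lp - A a a) = A zero2 one2 * A one2 zero2.
  have hm : Cm a a = 1 - Cp a a by rewrite -h0; ring.
  rewrite hm in h h1.
  by rewrite h -h1; ring.
exact: hd.
Qed.

Lemma diag_gt_lm a : lm < A a a.
Proof.
have := diag_between a; rewrite ltNge => h; rewrite ltNge; apply: contra h => h.
by rewrite mulr_le0_ge0 ?subr_le0 ?subr_ge0 // ltW // (le_lt_trans h).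
Qed.

(** By [coef_lead], the sign is that of an entry of [A] off the diagonal and of [A a a - lm] on
    it. *)
Lemma coef_lead_gt0 a b : 0 < Cp a b.
Proof.
have hd : 0 < lp - lm by rewrite subr_gt0.
rewrite -(pmulr_rgt0 _ hd) coef_lead.
case: eqVneq => [->|_] /=; last by rewrite mulr0 subr0.
by rewrite mulr1 subr_gt0 diag_gt_lm.
Qed.

(** The trace is positive, hence [- lp < lm]. *)
Lemma eigen_abs : `|lm| < lp.
Proof.
rewrite ltr_norml hlml andbT.
have := hlml; have := eigen_trace; have := hA zero2 zero2; have := hA one2 one2; lra.
Qed.

Lemma eigen_lead_gt0 : 0 < lp.
Proof. exact: le_lt_trans (normr_ge0 _) eigen_abs. Qed.

(** Identifies the two factors whose logarithms enter the pressure formula; for positive [n] the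
    right-hand side is positive, which allows the logarithm to be split. *)
Lemma expr_ratio n a b :
  Cp a b * (1 + Cm a b / Cp a b * (lm / lp) ^+ n) = (A ^+ n) a b / lp ^+ n.
Proof.
have hc := coef_lead_gt0 a b; have hl := eigen_lead_gt0.
have hln : lp ^+ n != 0 by rewrite expf_neq0 // gt_eqF.
rewrite hC expr_div_n; field.
by rewrite hln gt_eqF.
Qed.

(* Writing s for the sum of the off-diagonal entries of Cp, the entries of
   A ^+ n sum to (lp ^+ n + lm ^+ n) + s * (lp ^+ n - lm ^+ n), where both
   summands are nonnegative. *)
Lemma sum_exprmx_bounds : exists c C : R, 0 < c /\
  forall n, c * lp ^+ n <= \sum_a \sum_b (A ^+ n) a b <= C * lp ^+ n.
Proof.
have hl := eigen_lead_gt0.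
pose s := Cp zero2 one2 + Cp one2 zero2.
have hs : 0 < s by rewrite addr_gt0 // coef_lead_gt0.
(* Multiplied by [lp - lm], the left side becomes the trace minus [2 * lm]. *)
have hdiag : Cp zero2 zero2 + Cp one2 one2 = 1.
  have hd : lp - lm != 0 by rewrite subr_eq0 gt_eqF.
  apply: (mulfI hd); rewrite mulrDr !coef_lead !eqxx !mulr1n.
  by have := eigen_trace; lra.
have hsum n : \sum_a \sum_b (A ^+ n) a b =
    (lp ^+ n + lm ^+ n) + s * (lp ^+ n - lm ^+ n).
  have hm a b : Cm a b = (a == b)%:R - Cp a b by rewrite -coef_sum; ring.
  rewrite sum_I2 !sum_I2 !hC !hm /= /s.
  have -> : Cp one2 one2 = 1 - Cp zero2 zero2 by rewrite -hdiag; ring.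
  by ring.
(* With [P = lp ^+ n] and [Q = lm ^+ n], the terms [P + Q] and [P - Q] lie between 0 and [2 * P] and
   add up to [2 * P]. *)
exists (2 * Num.min 1 s), (2 * (1 + s)); split.
  by rewrite mulr_gt0 // lt_min ltr01 hs.
move=> n; rewrite hsum.
have hn : `|lm ^+ n| <= lp ^+ n.
  by rewrite normrX lerXn2r ?nnegrE ?normr_ge0 // ltW // eigen_abs.
move: hn; rewrite ler_norml; move: (lp ^+ n) (lm ^+ n) => P Q /andP[h1 h2].
have hm1 : Num.min 1 s <= 1 by rewrite ge_min lexx.
have hms : Num.min 1 s <= s by rewrite ge_min lexx orbT.
by apply/andP; split; nra.
Qed.

End PositiveMatrix.

(** * Base-two logarithms and exponential growth up to constants *)

Section Exponential.

Variable R : realType.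

Lemma pow2_log2 (t : R) : 0 < t -> 2 `^ (log2 t) = t.
Proof.
move=> ht; rewrite /powR pnatr_eq0 /= /log2 divfK ?lnK //.
by rewrite gt_eqF // ln_gt0 // ltr1n.
Qed.

Lemma log2_pow2 (t : R) : log2 (2 `^ t) = t.
Proof. by rewrite /log2 ln_powR mulfK // gt_eqF // ln_gt0 // ltr1n. Qed.

Lemma log2M (s t : R) : 0 < s -> 0 < t -> log2 (s * t) = log2 s + log2 t.
Proof. by move=> hs ht; rewrite /log2 lnM ?posrE // mulrDl. Qed.

Lemma ler_log2 (s t : R) : 0 < s -> s <= t -> log2 s <= log2 t.
Proof.
move=> hs hst; rewrite /log2 ler_wpM2r ?invr_ge0 ?ln_ge0 ?ler1n //.
by rewrite ler_ln ?posrE // (lt_le_trans hs).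
Qed.

Lemma pow2D (s t : R) : 2 `^ (s + t) = 2 `^ s * 2 `^ t.
Proof. by rewrite powRD // pnatr_eq0 implybT. Qed.

Lemma pow2_mulrn (t : R) n : 2 `^ (t *+ n) = (2 `^ t) ^+ n.
Proof. by rewrite -[t *+ n]mulr_natr powRrM powR_mulrn // powR_ge0. Qed.

Definition exp_growth (q : R) (u : nat -> R) : Prop :=
  exists c C : R, 0 < c /\ forall n, c * q ^+ n <= u n <= C * q ^+ n.

(** The quotient [u n / q ^+ n] is positive and [p]-periodic, so its finitely many values have a
    positive minimum and a maximum. *)
Lemma exp_growth_recurrence (q : R) (u : nat -> R) p : (0 < p)%N -> 0 < q ->
  (forall n, 0 < u n) -> (forall n, u (p + n)%N = q ^+ p * u n) -> exp_growth q u.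
Proof.
move=> hp hq hu hrec.
have [c [C [hc hb]]] : exists c C : R, 0 < c /\
    forall n, (n < p)%N -> c * q ^+ n <= u n <= C * q ^+ n.
  elim: {hp hrec} p => [|N [c [C [hc IH]]]]; first by exists 1, 1.
  have hqN : 0 < q ^+ N by rewrite exprn_gt0.
  exists (Num.min c (u N / q ^+ N)), (Num.max C (u N / q ^+ N)); split.
    by rewrite lt_min hc divr_gt0.
  move=> n; rewrite ltnS leq_eqVlt => /orP[/eqP ->|/IH /andP[h1 h2]].
    apply/andP; split; first by rewrite -ler_pdivlMr // ge_min lexx orbT.
    by rewrite -ler_pdivrMr // le_max lexx orbT.
  have hqn : 0 <= q ^+ n by rewrite exprn_ge0 // ltW.
  apply/andP; split.
    by apply: le_trans h1; rewrite ler_wpM2r // ge_min lexx.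
  by apply: le_trans h2 _; rewrite ler_wpM2r // le_max lexx.
exists c, C; split=> // n; elim/ltn_ind: n => n IH.
case: (ltnP n p) => [/hb //|hn].
rewrite -(subnKC hn) hrec exprD !(mulrCA _ (q ^+ p)).
have hqp : 0 < q ^+ p by rewrite exprn_gt0.
by rewrite !ler_pM2l //; apply: IH; lia.
Qed.

(** Moves the starting position of the weights back by one. The index shift costs a factor [q], and
    [u 0] enters the constants separately. *)
Lemma exp_growth_shift (q m K : R) (u v : nat -> R) : 0 < q -> 0 < m -> 0 <= K ->
  0 < u 0%N -> (forall n, m * v n <= u n.+1 <= K * v n) ->
  exp_growth q v -> exp_growth q u.
Proof.
move=> hq hm hK hu0 huv [c [C [hc hv]]].
exists (Num.min (u 0%N) (m * c / q)), (Num.max (u 0%N) (K * C / q)); split.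
  by rewrite lt_min hu0 divr_gt0 // mulr_gt0.
case=> [|n].
  by rewrite expr0 !mulr1 ge_min lexx le_max lexx.
have hqn : 0 <= q ^+ n.+1 by rewrite exprn_ge0 // ltW.
have /andP[h1 h2] := huv n; have /andP[h3 h4] := hv n.
have hS (t : R) : t / q * q ^+ n.+1 = t * q ^+ n.
  by rewrite exprS mulrA divfK // gt_eqF.
apply/andP; split.
  apply: (@le_trans _ _ (m * c / q * q ^+ n.+1)).
    by rewrite ler_wpM2r // ge_min lexx orbT.
  by apply: le_trans h1; rewrite hS -mulrA ler_wpM2l // ltW.
apply: (@le_trans _ _ (K * C / q * q ^+ n.+1)).
  by apply: le_trans h2 _; rewrite hS -mulrA ler_wpM2l.
by rewrite ler_wpM2r // le_max lexx orbT.
Qed.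

Lemma exp_growth_cvg (L : R) (u : nat -> R) : exp_growth (2 `^ L) u ->
  (n.+1%:R)^-1 * log2 (u n) @[n --> \oo] --> L.
Proof.
move=> [c [C [hc hu]]].
(* At [n = 0] the bounds read [c <= u 0 <= C]. *)
have hC : 0 < C.
  by have /andP[] := hu 0%N; rewrite expr0 !mulr1 => h1 h2; lra.
have hq n : 0 < (2 `^ L) ^+ n by rewrite exprn_gt0 // powR_gt0.
(* There are [n] factors but the normalisation is by [n.+1]; the difference is the constant [- L],
   which vanishes in the limit. *)
have hlog n (t : R) : 0 < t -> log2 (t * (2 `^ L) ^+ n) = log2 t - L + n.+1%:R * L.
  by move=> ht; rewrite log2M // -pow2_mulrn log2_pow2 -[L *+ n]mulr_natl -natr1; ring.
have hlim (t : R) : (n.+1%:R)^-1 * (log2 t - L) + L @[n --> \oo] --> L.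
  rewrite -[X in _ --> X]add0r; apply: cvgD; last exact: cvg_cst.
  rewrite -[X in _ --> X](mul0r (log2 t - L)).
  by apply: cvgM; [exact: cvg_harmonic|exact: cvg_cst].
apply: squeeze_cvgr (hlim c) (hlim C).
apply: nearW => n; have /andP[h1 h2] := hu n.
have hn0 : (n.+1%:R : R) != 0 by rewrite pnatr_eq0.
have hcq : 0 < c * (2 `^ L) ^+ n by rewrite mulr_gt0.
have hE (t : R) : 0 < t ->
    n.+1%:R^-1 * (log2 t - L) + L = n.+1%:R^-1 * log2 (t * (2 `^ L) ^+ n).
  by move=> ht; rewrite hlog // [RHS]mulrDr mulKf.
rewrite !hE // !ler_pM2l ?invr_gt0 ?ltr0n //.
by rewrite !ler_log2 // (lt_le_trans hcq).
Qed.

End Exponential.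

(** * Sums over a period and gaps between pinned positions *)

Lemma sum_period (V : zmodType) (p : nat) (g : nat -> V) k :
  (0 < p)%N -> (forall i, g (i + p)%N = g i) ->
  \sum_(k <= i < k + p) g i = \sum_(i < p) g i.
Proof.
move=> hp hg; elim: k => [|k IH]; first by rewrite add0n big_mkord.
rewrite -IH addSn big_nat_recr /=; last by lia.
by rewrite hg addrC -big_ltn; last lia.
Qed.

Section PeriodicPair.

Variables (R : realType) (w x : conf) (p : nat) (A : 'M[R]_2).
Hypotheses (hp : (0 < p)%N) (hw : periodic_with w p) (hx : periodic_with x p).
Hypothesis hwx : cle w x.

Lemma periodic_nat (y : conf) k : periodic_with y p -> y (k + p)%N%:Z = y k%:Z.
Proof. by move=> hy; rewrite PoszD hy. Qed.

Lemma pinned_periodic k : pinned w x (k + p) = pinned w x k.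
Proof. by rewrite /pinned !periodic_nat. Qed.

Lemma weight_periodic k n : weight w x A (k + p) n = weight w x A k n.
Proof.
apply: eq_bigr => a _; elim: n k a => [|n IH] k a /=;
  rewrite /allowed !periodic_nat //.
by case: ifP => // _; apply: eq_bigr => b _; rewrite -addSn IH.
Qed.

(** By periodicity [k + p] is pinned, so a nearest later pinned position exists at distance at most
    [p]. *)
Lemma next_pinned k : pinned w x k ->
  exists d, [/\ (d < p)%N, pinned w x (k + d.+1) &
    forall i, (k < i <= k + d)%N -> ~~ pinned w x i].
Proof.
move=> hk.
have hex : exists d, pinned w x (k + d.+1).
  by exists p.-1; rewrite prednK // pinned_periodic.
case: (ex_minnP hex) => d hd hmin; exists d; split=> //.
  by have := hmin p.-1; rewrite prednK // pinned_periodic => /(_ hk); lia.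
move=> i hi; apply/negP => hpi.
have hi' : (k + (i - k.+1).+1 = i)%N by lia.
by have := hmin (i - k.+1)%N; rewrite hi' => /(_ hpi); lia.
Qed.

Lemma shiftn_nat (y : conf) k j : shiftn k%:Z y j%:Z = y (k + j)%N%:Z.
Proof. by rewrite /shiftn -PoszD addnC. Qed.

(** The index [l] counts the symbols of the pattern, both ends included, so the two pinned positions
    are [l.-1] apart. In between, [w <= x] makes being unpinned the same as showing 0 below 1. *)
Lemma mcondP k l a b : (2 <= l)%N ->
  reflect [/\ pinned w x k, a = w k%:Z, pinned w x (k + l.-1), b = w (k + l.-1)%N%:Z
           & forall i, (k < i < k + l.-1)%N -> ~~ pinned w x i]
          (mcond l a b (shiftn k%:Z w) (shiftn k%:Z x)).
Proof.
move=> hl; rewrite /mcond (shiftn_nat w k 0) (shiftn_nat x k 0) !shiftn_nat !addn0.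
apply: (iffP and5P).
- case=> /eqP h1 /eqP h2 /forallP h3 /eqP h4 /eqP h5; rewrite /pinned.
  split; rewrite ?h1 ?h2 ?h4 ?h5 // => i hi.
  have hil : (i - k < l)%N by lia.
  have /implyP := h3 (Ordinal hil); rewrite /= !shiftn_nat.
  have -> : (k + (i - k) = i)%N by lia.
  case/(_ _)/andP; first by lia.
  by move=> /eqP -> /eqP ->.
- case=> /eqP h1 -> /eqP h2 -> h3; rewrite -h1 -h2 !eqxx; split=> //.
  apply/forallP => j; apply/implyP => hj; rewrite !shiftn_nat.
  have [|-> ->] := unpinned hwx (k := (k + j)%N); last by rewrite !eqxx.
  by apply: h3; lia.
Qed.

Lemma mrhoE l a b : mrho w x p l a b =
  (\sum_(k < p) (mcond l a b (shiftn k%:Z w) (shiftn k%:Z x))%:R) / p%:R :> R.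
Proof.
rewrite /mrho -sum1_card natr_sum big_mkcond /=; congr (_ / _).
apply: eq_bigr => k _; case: (boolP (mcond _ _ _ _ _)) => h; first by rewrite mem_set.
by rewrite memNset //=; apply/negP.
Qed.

(** A longer gap starting at [k] would contain the pinned position [k + p] in its interior. *)
Lemma mrho_eq0 l a b : (p.+1 < l)%N -> mrho w x p l a b = 0 :> R.
Proof.
move=> hl; rewrite mrhoE big1 ?mul0r // => k _.
case: mcondP => //; first by lia.
case=> hk _ _ _ /(_ (k + p)%N); rewrite pinned_periodic hk => h.
by have : false by apply: h; lia.
Qed.

Variable G : 'I_2 -> 'I_2 -> nat -> R.

(** Contribution of the gap that starts at [k]. The cutoff loses nothing, since gaps have length at
    most [p], that is [l <= p.+1]. *)
Definition gap_sum (k : nat) : R :=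
  \sum_a \sum_b \sum_(2 <= l < p.+2)
    (mcond l a b (shiftn k%:Z w) (shiftn k%:Z x))%:R * G a b l.

Lemma gap_sum_unpinned k : ~~ pinned w x k -> gap_sum k = 0.
Proof.
move=> hk; rewrite /gap_sum big1 // => a _; rewrite big1 // => b _.
rewrite big_nat big1 // => l /andP[hl _].
by case: mcondP => //; [case=> hk'; rewrite hk' in hk | rewrite mul0r].
Qed.

Lemma gap_sum_pinned k d : (d < p)%N -> pinned w x k -> pinned w x (k + d.+1) ->
  (forall i, (k < i <= k + d)%N -> ~~ pinned w x i) ->
  gap_sum k = G (w k%:Z) (w (k + d.+1)%N%:Z) d.+2.
Proof.
move=> hdp hk hkd hfree.
(* The next pinned position determines the whole triple, so at most one term survives: a smaller [l]
   contradicts [hfree], a larger one the condition inside [mcond]. *)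
have hm l a b : (2 <= l)%N -> mcond l a b (shiftn k%:Z w) (shiftn k%:Z x) ->
    [/\ a = w k%:Z, b = w (k + d.+1)%N%:Z & l = d.+2].
  move=> hl /(mcondP _ _ _ hl) [_ -> hkl -> hfl].
  have -> : l = d.+2.
    case: (ltngtP l.-1 d.+1) => h; last by lia.
      by have /negP[] : ~~ pinned w x (k + l.-1) by apply: hfree; lia.
    by have /negP[] : ~~ pinned w x (k + d.+1) by apply: hfl; lia.
  by [].
rewrite /gap_sum (bigD1 (w k%:Z)) //= [X in _ + X]big1 ?addr0; last first.
  move=> a ha; rewrite big1 // => b _; rewrite big_nat big1 // => l /andP[hl _].
  case: (boolP (mcond _ _ _ _ _)) => [/(hm _ _ _ hl)[h _ _]|]; last by rewrite mul0r.
  by rewrite h eqxx in ha.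
rewrite (bigD1 (w (k + d.+1)%N%:Z)) //= [X in _ + X]big1 ?addr0; last first.
  move=> b hb; rewrite big_nat big1 // => l /andP[hl _].
  case: (boolP (mcond _ _ _ _ _)) => [/(hm _ _ _ hl)[_ h _]|]; last by rewrite mul0r.
  by rewrite h eqxx in hb.
rewrite (bigD1_seq d.+2) ?iota_uniq ?mem_index_iota //=.
rewrite big_seq_cond big1 ?addr0; last first.
  move=> l; rewrite mem_index_iota => /andP[/andP[hl _] hne].
  case: (boolP (mcond _ _ _ _ _)) => [/(hm _ _ _ hl)[_ _ h]|]; last by rewrite mul0r.
  by rewrite h eqxx in hne.
have -> : mcond d.+2 (w k%:Z) (w (k + d.+1)%N%:Z) (shiftn k%:Z w) (shiftn k%:Z x).
  by apply/mcondP => //; split=> // i hi; apply: hfree; rewrite /= in hi; lia.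
by rewrite mul1r.
Qed.

Lemma gap_sum_periodic k : gap_sum (k + p) = gap_sum k.
Proof.
have h y : periodic_with y p -> shiftn (k + p)%N%:Z y = shiftn k%:Z y.
  by move=> hy; apply/funext => i; rewrite /shiftn PoszD addrA hy.
by rewrite /gap_sum !h.
Qed.

Lemma sum_mrho_series : 
  \sum_a \sum_b \sum_(2 <= l < p.+2) mrho w x p l a b * G a b l =
  (\sum_(k < p) gap_sum k) / p%:R.
Proof.
rewrite /gap_sum [X in X / _]exchange_big /= mulr_suml; apply: eq_bigr => a _.
rewrite [X in X / _]exchange_big /= mulr_suml; apply: eq_bigr => b _.
rewrite [X in X / _]exchange_big /= mulr_suml; apply: eq_bigr => l _.
by rewrite mrhoE -mulr_suml mulrAC.
Qed.

(** By [mrho_eq0] the partial sums are eventually constant. *)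
Lemma mrho_series_lim (F : nat -> R) a b :
  \big[+%R/0%R]_(2 <= l <oo) (mrho w x p l a b * F l) =
  \sum_(2 <= l < p.+2) mrho w x p l a b * F l.
Proof.
apply: lim_near_cst => //; exists p.+2 => //= n /= hn.
rewrite (big_cat_nat (n := p.+2)) //= [X in _ + X]big_nat [X in _ + X]big1 ?addr0 //.
by move=> l /andP[hl _]; rewrite mrho_eq0 ?mul0r //; lia.
Qed.

End PeriodicPair.

(** * Exact growth rate of the weights *)

Section Growth.

Variables (R : realType) (w x : conf) (p : nat) (A : 'M[R]_2) (lp lm : R).
Variables (Cp Cm : 'I_2 -> 'I_2 -> R) (m K : R).
Hypotheses (hp : (0 < p)%N) (hw : periodic_with w p) (hx : periodic_with x p).
Hypotheses (hwx : cle w x) (hm : 0 < m) (hA : forall a b, m <= A a b <= K).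
Hypotheses (hlml : lm < lp).
Hypothesis hC : forall a b n, (A ^+ n) a b = Cp a b * lp ^+ n + Cm a b * lm ^+ n.

(** For [l >= 2] this is the logarithm of the gap factor [(A ^+ l.-1) a b] divided by
    [lp ^+ l.-1]. *)
Definition gap_log (a b : 'I_2) (l : nat) : R :=
  log2 (Cp a b) + log2 (1 + Cm a b / Cp a b * (lm / lp) ^+ l.-1).

Definition rate : R :=
  log2 lp + (\sum_(k < p) gap_sum w x p gap_log k) / p%:R.

Let hA0 a b : 0 < A a b.
Proof. by have /andP[h _] := hA a b; exact: lt_le_trans h. Qed.

Let hlp : 0 < lp.
Proof. exact: (eigen_lead_gt0 hA0 hlml hC). Qed.

Lemma pow2_gap_log a b d :
  2 `^ (log2 lp *+ d.+1 + gap_log a b d.+2) = (A ^+ d.+1) a b.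
Proof.
have hc := coef_lead_gt0 hA0 hlml hC a b.
have hr := expr_ratio hA0 hlml hC d.+1 a b.
have hn : 0 < lp ^+ d.+1 by rewrite exprn_gt0.
have h1 : 0 < 1 + Cm a b / Cp a b * (lm / lp) ^+ d.+1.
  by rewrite -(pmulr_rgt0 _ hc) hr divr_gt0 //; apply: exprmx_gt0.
rewrite /gap_log -log2M // hr pow2D pow2_mulrn !pow2_log2 //; last first.
  by rewrite divr_gt0 //; apply: exprmx_gt0.
by rewrite mulrCA divff ?mulr1 // gt_eqF.
Qed.

(** Strong induction on the distance, jumping to the next pinned position. Each position contributes
    [log2 lp], and the one opening a gap also contributes its [gap_log]. *)
Lemma weight_between t : forall k k' n, k' = (k + t)%N ->
  pinned w x k -> pinned w x k' ->
  weight w x A k (t + n) =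
    2 `^ (\sum_(k <= i < k') (log2 lp + gap_sum w x p gap_log i)) *
    weight w x A k' n.
Proof.
elim/ltn_ind: t => t IH k k' n -> hk hk'.
case: (posnP t) => [->|ht].
  by rewrite addn0 big_geq // powRr0 mul1r.
have [d [hd hkd hfree]] := next_pinned hp hw hx hk.
(* The jump cannot overshoot [k'], which is itself pinned. *)
have hdt : (d < t)%N.
  rewrite ltnNge; apply/negP => htd.
  by have /negP[] : ~~ pinned w x (k + t) by apply: hfree; lia.
rewrite (big_cat_nat (n := (k + d.+1)%N)) //=; [|lia|lia].
rewrite pow2D -mulrA -(IH (t - d.+1)%N) //; [|lia|lia].
have -> : (t + n = d.+1 + (t - d.+1 + n))%N by lia.
rewrite (weight_gap _ hwx) //; congr (_ * _).
have hgap : gap_sum w x p gap_log k = gap_log (w k%:Z) (w (k + d.+1)%N%:Z) d.+2.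
  exact: gap_sum_pinned.
rewrite -pow2_gap_log -hgap.
congr (2 `^ _); rewrite big_split /= sumr_const_nat addKn; congr (_ + _).
rewrite big_ltn; last lia.
rewrite big_nat big1 ?addr0 // => i hi.
by rewrite gap_sum_unpinned //; apply: hfree; lia.
Qed.

(** Between [k] and [k + p] the exponent sums to [p] times [rate], which yields an exact recurrence
    of step [p]. *)
Lemma weight_growth_pinned k : pinned w x k -> exp_growth (2 `^ rate) (weight w x A k).
Proof.
move=> hk; apply: (exp_growth_recurrence (p := p)) => //.
- by move=> n; apply: (weight_gt0 hwx hm hA).
move=> n; rewrite (weight_between (k' := k + p)) //; last by rewrite pinned_periodic.
rewrite weight_periodic //; congr (_ * _); rewrite -pow2_mulrn; congr (2 `^ _).
rewrite sum_period //; last by move=> i; rewrite gap_sum_periodic.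
rewrite big_split /= sumr_const card_ord /rate mulrnDl; congr (_ + _).
by rewrite -[(_ / _) *+ p]mulr_natr divfK // pnatr_eq0 -lt0n.
Qed.

Lemma weight_growth_unpinned k : (forall i, ~~ pinned w x i) ->
  exp_growth (2 `^ rate) (weight w x A k).
Proof.
move=> hfree; have -> : rate = log2 lp.
  by rewrite /rate big1 ?mul0r ?addr0 // => i _; rewrite gap_sum_unpinned.
rewrite pow2_log2 //.
have [c [C [hc hcC]]] := sum_exprmx_bounds hA0 hlml hC.
exists c, C; split=> // n; have -> : weight w x A k n = \sum_a \sum_b (A ^+ n) a b.
  (* For [n = 0] the entries of the identity matrix are summed, one for each symbol. *)
  case: n => [|n]; last exact: weight_unpinned.
  apply: eq_bigr => a _; rewrite /= allowed_unpinned // expr0.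
  rewrite (bigD1 a) //= big1 ?addr0 ?mxE ?eqxx // => b hb.
  by rewrite mxE eq_sym (negbTE hb).
exact: hcC.
Qed.

Lemma weight_growth k : exp_growth (2 `^ rate) (weight w x A k).
Proof.
have hK : 0 <= 2 * K.
  have /andP[h1 h2] := hA zero2 zero2.
  by rewrite mulr_ge0 // (le_trans _ h2) // ltW.
have [/existsP[r hr]|/existsPn hfree] := boolP [exists r : 'I_p, pinned w x r]; last first.
  apply: weight_growth_unpinned => i; rewrite (divn_eq i p) addnC.
  elim: (i %/ p)%N => [|N IH].
    by rewrite mul0n addn0; exact: (hfree (Ordinal (ltn_pmod i hp))).
  by rewrite mulSn addnCA addnC pinned_periodic.
have hpin : pinned w x (r + k * p).
  elim: k => [|k IH]; first by rewrite mul0n addn0.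
  by rewrite mulSn addnCA addnC pinned_periodic.
(* A pinned position at or after [k]; the growth estimate is carried back from it to [k], one
   position at a time. *)
have hkn : (k <= r + k * p)%N by nia.
move: (r + k * p)%N hkn hpin => {r hr} r hkr hr.
have [j hj] : exists j, (r = k + j)%N by exists (r - k)%N; lia.
elim: j k hj {hkr} => [|j IH] k hj.
  by rewrite addn0 in hj; rewrite -hj; exact: weight_growth_pinned.
have {}IH := IH k.+1 ltac:(lia).
apply: (exp_growth_shift (m := m) (K := 2 * K) (v := weight w x A k.+1)) => //.
- exact: (weight_gt0 hwx hm hA).
- exact: (weight_step hwx).
Qed.

Lemma rateE : rate = log2 lp
    + \sum_(a : 'I_2) \sum_(b : 'I_2)
        \big[+%R/0%R]_(2 <= l <oo) (mrho w x p l a b * log2 (Cp a b))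
    + \sum_(a : 'I_2) \sum_(b : 'I_2)
        \big[+%R/0%R]_(2 <= l <oo) (mrho w x p l a b *
           log2 (1 + Cm a b / Cp a b * (lm / lp) ^+ l.-1)).
Proof.
rewrite /rate -addrA; congr (_ + _).
rewrite -sum_mrho_series -big_split; apply: eq_bigr => a _ /=.
rewrite -big_split; apply: eq_bigr => b _ /=.
rewrite !mrho_series_lim //.
rewrite -big_split; apply: eq_bigr => l _ /=.
by rewrite mulrDr.
Qed.

End Growth.

(** * Blocks of the interval shift and pressure sums *)

Lemma periodic_mod (y : conf) p i j : periodic_with y p ->
  y (i + j) = y (i + (j %% p%:Z)%Z).
Proof.
move=> hy; have hmul i0 (q : nat) : y (i0 + (q * p)%N%:Z) = y i0.
  elim: q => [|q IH]; first by rewrite mul0n addr0.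
  by rewrite mulSn PoszD addrCA addrC hy.
rewrite {1}(divz_eq j p%:Z); case: (j %/ p%:Z)%Z => q.
  by rewrite -PoszM [X in i + X]addrC addrA hmul.
rewrite NegzE mulNr -PoszM -[LHS](hmul _ q.+1); congr (y _); ring.
Qed.

(** By periodicity only the residue modulo [p] of the shift matters. *)
Lemma blocks_compatible (w x : conf) p n (f : {ffun 'I_n.+1 -> 'I_2}) :
  (0 < p)%N -> periodic_with w p -> periodic_with x p -> cle w x ->
  blocks (interval_shift w x) f <-> exists k : 'I_p, compatible w x k f.
Proof.
move=> hp hw hx hwx; have hp0 : p%:Z != 0 by rewrite eqz_nat -lt0n.
split=> [[y [[z [t [hwz [hzx ->]]]] hcyl]]|[k /forallP hk]].
- have hk0 : `|(t %% p%:Z)%Z|%N%:Z = (t %% p%:Z)%Z by rewrite gez0_abs ?modz_ge0.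
  have hk : (`|(t %% p%:Z)%Z| < p)%N by rewrite -ltz_nat hk0 ltz_pmod.
  exists (Ordinal hk); apply/forallP => i; rewrite -hcyl /allowed /shiftn /=.
  rewrite PoszD hk0 addrC -!periodic_mod //.
  by rewrite hwz hzx.
(* The word is placed at position [k] and continued by [w] on both sides. *)
- pose z : conf := fun i : int => if (k%:Z <= i) && (i < (k + n.+1)%N%:Z)
    then f (inord `|i - k%:Z|%N) else w i.
  exists (shiftn k%:Z z); split; last first.
    move=> i; rewrite /shiftn /z -PoszD lez_nat ltz_nat leq_addl /=.
    rewrite addnC ltn_add2l ltn_ord PoszD addrC addKr.
    by congr (f _); apply/val_inj; rewrite /= inordK.
  have hz i : (w i <= z i <= x i)%N.
    rewrite /z; case: ifP => [/andP[h1 h2]|_]; last by rewrite leqnn hwx.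
    have hi : (`|i - k%:Z| < n.+1)%N by lia.
    have := hk (inord `|i - k%:Z|%N); rewrite inordK // /allowed.
    by have -> : (k + `|i - k%:Z|)%N%:Z = i by lia.
  by exists z, k%:Z; split; [|split] => // i; have /andP[] := hz i.
Qed.

Section Pressure.

Variables (R : realType) (w x : conf) (p : nat) (phi : 'I_2 -> 'I_2 -> R).
Hypotheses (hp : (0 < p)%N) (hw : periodic_with w p) (hx : periodic_with x p).
Hypothesis hwx : cle w x.

Definition phi_bound : R := \sum_a \sum_b `|phi a b|.

Lemma norm_phi_le a b : `|phi a b| <= phi_bound.
Proof.
rewrite /phi_bound (bigD1 a) //= (bigD1 b) //= -addrA lerDl.
by rewrite addr_ge0 ?sumr_ge0 // => *; rewrite ?sumr_ge0.
Qed.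

Lemma Mphi_bounds a b : 2 `^ (- phi_bound) <= Mphi phi a b <= 2 `^ phi_bound.
Proof.
have := norm_phi_le a b; rewrite ler_norml => /andP[h1 h2].
by rewrite mxE !ler_powR // ler1n.
Qed.

Lemma word_weight_Mphi n (f : {ffun 'I_n.+1 -> 'I_2}) :
  word_weight (Mphi phi) f =
  2 `^ (\sum_(j < n) phi (f (inord j)) (f (inord j.+1))).
Proof.
rewrite (big_morph (powR 2) (@pow2D R) (powRr0 2)).
by apply: eq_bigr => j _; rewrite mxE.
Qed.

Lemma birk_cyl n (f : {ffun 'I_n.+1 -> 'I_2}) y : cyl f y ->
  birk phi n.+1 y = \sum_(j < n) phi (f (inord j)) (f (inord j.+1))
                    + phi (f ord_max) (y n.+1%:Z).
Proof.
move=> hy; rewrite /birk big_ord_recr /=; congr (_ + phi _ _); last first.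
  by rewrite -hy.
apply: eq_bigr => j _; have hj := ltn_ord j.
by rewrite -!hy !inordK //; lia.
Qed.

Lemma sup_birk_bounds X n (f : {ffun 'I_n.+1 -> 'I_2}) : blocks X f ->
  2 `^ (- phi_bound) * word_weight (Mphi phi) f <=
    2 `^ (sup [set birk phi n.+1 y | y in X `&` cyl f]) <=
  2 `^ phi_bound * word_weight (Mphi phi) f.
Proof.
move=> [y [hy hcy]]; rewrite word_weight_Mphi -!pow2D.
set s := \sum_(j < n) _.
have hb z : cyl f z -> - phi_bound + s <= birk phi n.+1 z <= phi_bound + s.
  move=> hz; rewrite (birk_cyl hz) -/s.
  have := norm_phi_le (f ord_max) (z n.+1%:Z); rewrite ler_norml => /andP[h1 h2].
  by rewrite addrC lerD2l h1 addrC lerD2r h2.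
(* Together with [hmem], this ensures that [sup] is a genuine supremum and not its default value. *)
have hub : ubound [set birk phi n.+1 y | y in X `&` cyl f] (phi_bound + s).
  by move=> _ [z [_ hz] <-]; have /andP[] := hb z hz.
have hmem : [set birk phi n.+1 y | y in X `&` cyl f] (birk phi n.+1 y) by exists y.
rewrite !ler_powR ?ler1n //.
- have /andP[h _] := hb y hcy; apply: le_trans h _.
  by apply: ub_le_sup => //; exists (phi_bound + s).
- by apply: ge_sup => //; exists (birk phi n.+1 y).
Qed.

(** From below, every word compatible at position 0 is a block. From above, every block is
    compatible at one of [p] positions, so the sum of the [p] weights dominates. *)
Lemma block_sum_growth (q : R) : 0 < q ->
  (forall k, exp_growth q (weight w x (Mphi phi) k)) ->
  exp_growth q (fun n =>
    \sum_(f : {ffun 'I_n.+1 -> 'I_2} | `[< blocks (interval_shift w x) f >])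
       2 `^ (sup [set birk phi n.+1 y | y in interval_shift w x `&` cyl f])).
Proof.
move=> hq hg.
have hww n (f : {ffun 'I_n.+1 -> 'I_2}) : 0 <= word_weight (Mphi phi) f.
  by rewrite word_weight_Mphi powR_ge0.
have [c0 [C0 [hc0 hw0]]] := hg 0%N.
(* A common upper constant, as a maximum over the [p] starting positions. *)
have [C hC] : exists C, forall n (k : 'I_p),
    weight w x (Mphi phi) k n <= C * q ^+ n.
  suff [C hC] : exists C, forall n k, (k < p)%N ->
      weight w x (Mphi phi) k n <= C * q ^+ n by exists C => n k; exact: hC.
  elim: (p) => [|N [C IH]]; first by exists 0.
  have [c' [C' [_ hC']]] := hg N; exists (Num.max C C') => n k.
  have hqn : 0 <= q ^+ n by rewrite exprn_ge0 // ltW.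
  rewrite ltnS leq_eqVlt => /orP[/eqP ->|/IH h].
    have /andP[_ h] := hC' n; apply: le_trans h _.
    by rewrite ler_wpM2r // le_max lexx orbT.
  by apply: le_trans (h n) _; rewrite ler_wpM2r // le_max lexx.
exists (2 `^ (- phi_bound) * c0), (2 `^ phi_bound * (C *+ p)).
split; first by rewrite mulr_gt0 // powR_gt0.
move=> n; apply/andP; split.
- have /andP[h _] := hw0 n.
  rewrite -mulrA; apply: (@le_trans _ _ (2 `^ (- phi_bound) * weight w x (Mphi phi) 0 n)).
    by rewrite ler_wpM2l // powR_ge0.
  rewrite -sum_word_weight mulr_sumr big_mkcond [leRHS]big_mkcond /=.
  apply: ler_sum => f _; case: ifP => hf; last first.
    by case: ifP => // _; rewrite powR_ge0.
  have hb : blocks (interval_shift w x) f.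
    by apply/(blocks_compatible _ hp) => //; exists (Ordinal hp).
  by rewrite asboolT //; have /andP[] := sup_birk_bounds hb.
- apply: (@le_trans _ _ (2 `^ phi_bound *
      \sum_(k < p) weight w x (Mphi phi) k n)); last first.
    rewrite -mulrA ler_wpM2l ?powR_ge0 // mulrnAl -[p in leRHS]card_ord -sumr_const.
    by apply: ler_sum => k _; exact: hC.
  under [X in _ * X]eq_bigr do rewrite -sum_word_weight big_mkcond /=.
  rewrite exchange_big /= mulr_sumr big_mkcond /=.
  apply: ler_sum => f _; case: asboolP => hb; last first.
    by rewrite mulr_ge0 ?powR_ge0 // sumr_ge0 // => k _; case: ifP.
  have /andP[_ h] := sup_birk_bounds hb; apply: le_trans h _.
  have [k hk] := (blocks_compatible _ hp hw hx hwx).1 hb.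
  rewrite ler_wpM2l ?powR_ge0 // (bigD1 k) //= hk lerDl.
  by rewrite sumr_ge0 // => j _; case: ifP.
Qed.

End Pressure.

Theorem theorem6p2 (R : realType) (w x : conf) (p : nat)
  (hp : (0 < p)%N) (hw : periodic_with w p) (hx : periodic_with x p)
  (hwx : cle w x)
  (phi : 'I_2 -> 'I_2 -> R)
  (lp lm : R) (hlml : lm < lp)
  (hlp : eigenvalue (Mphi phi) lp) (hlm : eigenvalue (Mphi phi) lm)
  (Cp Cm : 'I_2 -> 'I_2 -> R)
  (hC : forall (a b : 'I_2) (n : nat),
      (Mphi phi ^+ n) a b = Cp a b * lp ^+ n + Cm a b * lm ^+ n) :
  pressure_seq (interval_shift w x) phi @ \oo -->
    log2 lp
    + \sum_(a : 'I_2) \sum_(b : 'I_2)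
        \big[+%R/0%R]_(2 <= l <oo) (mrho w x p l a b * log2 (Cp a b))
    + \sum_(a : 'I_2) \sum_(b : 'I_2)
        \big[+%R/0%R]_(2 <= l <oo) (mrho w x p l a b *
           log2 (1 + Cm a b / Cp a b * (lm / lp) ^+ l.-1)).
Proof.
rewrite -(rateE (p := p) lp lm Cp Cm) //.
(* Dropping the term of index 0 leaves words of length [n.+1], which have [n] transitions. *)
rewrite -cvg_shiftS; apply: exp_growth_cvg.
apply: (block_sum_growth (p := p)) => //.
move=> k; apply: (weight_growth (m := 2 `^ (- phi_bound phi)) (K := 2 `^ phi_bound phi)) => //.
exact: Mphi_bounds.
Qed.
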